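(* Let $X$ be a topological space and let $\mathscr{B}$ be a family of covers of $X$ which is Ramseyan and finite-to-one derefinable. Then the following are equivalent: (1) $X$ satisfies $\mathsf{S}_1(\mathcal{O},\mathcal{O})$ and $\mathsf{U}_{\mathrm{fin}}(\mathcal{O},\mathscr{B})$. (2) $X$ satisfies $\mathsf{S}_1(\Lambda,\gimel(\mathscr{B}))$. (3) $X$ satisfies $\mathsf{S}_1(\Omega,\gimel(\mathscr{B}))$. (4) ONE has no winning strategy in the game $\mathsf{G}_1(\Omega,\gimel(\mathscr{B}))$. (5) $\Omega\to(\gimel(\mathscr{B}))^2_2$ holds. (6) $\Omega\to(\gimel(\mathscr{B}))^2_k$ holds for all positive integers $k$.
   Context: Convention: a cover of the topological space $X$ is always a countable collection $\mathcal{U}$ of open subsets of $X$ such that $\bigcup\mathcal{U}=X$ and $X\notin\mathcal{U}$. $\mathscr{A},\mathscr{B}$ denote families of such covers of the underlying space $X$. $\mathcal{O}$ is the family of all covers of $X$. $\mathcal{U}$ is a large cover if each $x\in X$ belongs to infinitely many $U\in\mathcal{U}$; $\Lambda$ is the family of all large covers of $X$. $\mathcal{U}$ is an $\omega$-cover if $X\notin\mathcal{U}$ and for each finite $F\subseteq X$ there is $U\in\mathcal{U}$ with $F\subseteq U$; $\Omega$ is the family of all $\omega$-covers of $X$. $\mathscr{A}$ is Ramseyan if for each $\mathcal{U}\in\mathscr{A}$ and each partition of $\mathcal{U}$ into finitely many (equivalently, two) pieces, one of these pieces belongs to $\mathscr{A}$. A cover $\mathcal{V}$ is a finite-to-one derefinement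 of a cover $\mathcal{U}$ if there is a finite-to-one surjection $f:\mathcal{U}\to\mathcal{V}$ such that $U\subseteq f(U)$ for each $U\in\mathcal{U}$. $\mathscr{A}$ is finite-to-one derefinable if for each $\mathcal{U}\in\mathscr{A}$ and each finite-to-one derefinement $\mathcal{V}\in\mathcal{O}$ of $\mathcal{U}$, $\mathcal{V}\in\mathscr{A}$. A cover $\mathcal{U}$ of $X$ is multifinite if there is a partition of $\mathcal{U}$ into infinitely many finite covers of $X$. $\gimel(\mathscr{A})$ is the family of all covers $\mathcal{U}$ of $X$ such that either $\mathcal{U}$ is multifinite, or there is a partition $\mathcal{P}$ of $\mathcal{U}$ into finite sets such that $\{\bigcup\mathcal{F}:\mathcal{F}\in\mathcal{P}\}\setminus\{X\}\in\mathscr{A}$. $\mathsf{U}_{\mathrm{fin}}(\mathscr{A},\mathscr{B})$: for each sequence $\{\mathcal{U}_n\}_{n\in\mathbb{N}}$ of elements of $\mathscr{A}$ which do not contain a finite subcover, there are finite (possibly empty) subsets $\mathcal{F}_n\subseteq\mathcal{U}_n$, $n\in\mathbb{N}$, such that $\{\bigcup\mathcal{F}_n:n\in\mathbb{N}\}\in\mathscr{B}$. $\mathsf{S}_1(\mathscr{A},\mathscr{B})$: for each sequence $\{\mathcal{U}_n\}_{n\in\mathbb{N}}$ of elements of $\mathscr{A}$ there are $U_n\in\mathcal{U}_n$, $n\in\mathbb{N}$, such that $\{U_n:n\in\mathbb{N}\}\in\mathscr{B}$. $\mathsf{G}_1(\mathscr{A},\mathscr{B})$ is the game of two players, ONE and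 TWO, with an inning for each natural number $n$: in the $n$th inning ONE chooses $\mathcal{U}_n\in\mathscr{A}$ and TWO answers with $U_n\in\mathcal{U}_n$. TWO wins if $\{U_n:n\in\mathbb{N}\}\in\mathscr{B}$; otherwise ONE wins. $[A]^n$ denotes the set of $n$-element subsets of $A$. For positive integers $n,k$, the ordinary partition relation $\mathscr{A}\to(\mathscr{B})^n_k$ means: for each $A\in\mathscr{A}$ and each $f:[A]^n\to\{1,\dots,k\}$ there is $B\subseteq A$ such that $B\in\mathscr{B}$ and $f|_{[B]^n}$ is constant. *)

(* Defs.v *)
(* Built on MathComp-Analysis: [set T], [topologicalType], [open]. *)
From mathcomp Require Import all_boot.
From mathcomp Require Import all_classical topology.

Set Implicit Arguments.
Unset Strict Implicit.
Unset Printing Implicit Defensive.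

Local Open Scope classical_set_scope.

(* A collection of subsets of X is a [set (set X)]; a family of such
   collections is a [set (set (set X))]. *)

Definition union_of (T : Type) (F : set (set T)) : set T :=
  \bigcup_(V in F) V.

Definition set_partition (T : Type) (P : set (set T)) (A : set T) : Prop :=
  partition P id A.

Section Covers.
Variable X : topologicalType.
Implicit Types (U V F : set (set X)) (A B : set (set (set X))).

Definition covers : set (set (set X)) :=
  [set U | [/\ countable U, U `<=` open, union_of U = setT & ~ U setT]].

Definition large_covers : set (set (set X)) :=
  [set U | covers U /\ forall x : X, infinite_set [set V | U V /\ V x]].

Definition omega_covers : set (set (set X)) :=
  [set U | covers U /\
    forall F : set X, finite_set F -> exists2 V, U V & F `<=` V].

Definition ramseyan A : Prop :=
  forall U, A U -> forall P : set (set (set X)),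
    set_partition P U -> finite_set P -> exists2 V, P V & A V.

(* The map U -> V is represented by the restriction to U of a total map on
   subsets of X. *)
Definition finite_to_one_derefinement U V : Prop :=
  exists f : set X -> set X,
    [/\ f @` U = V,
        forall W, V W -> finite_set (U `&` f @^-1` [set W])
      & forall W, U W -> W `<=` f W].

Definition finite_to_one_derefinable A : Prop :=
  forall U V, A U -> covers V -> finite_to_one_derefinement U V -> A V.

Definition multifinite U : Prop :=
  covers U /\
  exists P : set (set (set X)),
    [/\ set_partition P U, infinite_set P
      & forall F, P F -> finite_set F /\ covers F].

Definition gimel A : set (set (set X)) :=
  [set U | covers U /\
    (multifinite U \/
     exists P : set (set (set X)),
       [/\ set_partition P U, forall F, P F -> finite_set F
         & A ((@union_of X @` P) `\ setT)])].

Definition has_finite_subcover U : Prop :=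
  exists F, [/\ F `<=` U, finite_set F & covers F].

Definition Ufin A B : Prop :=
  forall Us : nat -> set (set X),
    (forall n, A (Us n) /\ ~ has_finite_subcover (Us n)) ->
    exists Fs : nat -> set (set X),
      (forall n, Fs n `<=` Us n /\ finite_set (Fs n)) /\
      B (range (fun n => union_of (Fs n))).

Definition S1 A B : Prop :=
  forall Us : nat -> set (set X), (forall n, A (Us n)) ->
    exists V : nat -> set X, (forall n, Us n (V n)) /\ B (range V).

(* A strategy for ONE maps the sequence of the moves TWO has made so far to
   ONE's next move, so [sigma (mkseq V n)] is ONE's move in inning n when TWO
   has played V 0, ..., V (n - 1). *)
Definition legal_moves_TWO (sigma : seq (set X) -> set (set X))
    (V : nat -> set X) (n : nat) : Prop :=
  forall m, (m < n)%N -> sigma (mkseq V m) (V m).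

Definition strategy_ONE_G1 A (sigma : seq (set X) -> set (set X)) : Prop :=
  forall (V : nat -> set X) (n : nat),
    legal_moves_TWO sigma V n -> A (sigma (mkseq V n)).

Definition ONE_wins_G1 A B : Prop :=
  exists sigma : seq (set X) -> set (set X),
    strategy_ONE_G1 A sigma /\
    forall V : nat -> set X,
      (forall n, legal_moves_TWO sigma V n) -> ~ B (range V).

Definition nsubsets (T : Type) (D : set T) (n : nat) : set (set T) :=
  [set s | s `<=` D /\ (s #= `I_n)%card].

(* The colouring of [U]^n is represented by the restriction of a total map,
   and the k colours by 'I_k; this is meant for k > 0. *)
Definition arrows A B (n k : nat) : Prop :=
  forall U, A U -> forall f : set (set X) -> 'I_k,
    exists V, [/\ V `<=` U, B V &
      exists c : 'I_k, forall s, nsubsets V n s -> f s = c].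

End Covers.

Arguments covers : clear implicits.
Arguments large_covers : clear implicits.
Arguments omega_covers : clear implicits.

(* Main.v *)
Require Import Defs.
From mathcomp Require Import all_boot.
From mathcomp Require Import all_classical topology.
From mathcomp Require Import zify.

Set Implicit Arguments.
Unset Strict Implicit.
Unset Printing Implicit Defensive.

Local Open Scope classical_set_scope.

(** The family [gimel B] matters only through one inclusion: under
    [Ufin (covers X) B] every large cover belongs to [gimel B]
    ([large_sub_gimel]).  To see it, enumerate the large cover injectively.  If
    every tail has a finite subcover, cutting the enumeration into consecutive
    finite covers shows that it is multifinite.  Otherwise apply
    [Ufin (covers X) B] to the tails: the finite sets it selects lie in windows
    of the enumeration, and by cutting the enumeration into fast growing
    intervals each window meets at most two consecutive ones.  The Ramsey
    property lets one keep only the windows that start in intervals of one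
    parity; each of these lies in a single block of two consecutive intervals,
    so the unions of the blocks form a finite-to-one derefinement of a member of
    [B].

    Since omega-covers are large ([omega_large]), the selection principles and
    the game follow from [S1 (covers X) (covers X)] and [Ufin (covers X) B] once
    TWO can defeat every strategy of ONE that plays large covers, with a large
    cover as the outcome.  This is Pawlikowski's
    theorem on the Rothberger game: first, as in Hurewicz's theorem on the Menger
    game, find bounds for the innings such that each point is infinitely often
    covered by the bounded answers, whatever bounded play came before
    ([menger_branch]); then use [S1 (covers X) (covers X)] to guess, for
    infinitely many innings at once, which bounded answer to give in each
    possible position ([pawlikowski]).

    The absence of a winning strategy gives the partition relations
    ([arrows_of_no_winning_strategy]): after thinning out an omega-cover so that
    the colour of a pair depends only on its first element and is always the
    same, ONE can force TWO to build a homogeneous set.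

    For the way back, [S1 (omega_covers X) (gimel B)] and the partition relation
    for two colours have a common weak form, [dispersed_selection]: there is a
    member of [gimel B] whose elements are contained in elements of the given
    omega-covers, at most one from each. It yields [S1 (covers X) (covers X)] by
    letting each cover consist of finite unions with one summand from each cover
    in a block ([rothberger_of_dispersed]), and [Ufin (covers X) B] by letting
    each cover refine all earlier ones, which rules out the multifinite case and
    lets one move the finite unions down to any earlier index
    ([Ufin_of_dispersed]). *)

(** * Enumerations, finite sets and recursion on histories *)

Lemma countable_enumeration (T : choiceType) (A : set T) :
  countable A -> A !=set0 -> exists u : nat -> T, range u = A.
Proof.
move=> /countable_injP[f finj] [a Aa].
exists (fun n => xget a [set x | A x /\ f x = n]).
apply/seteqP; split=> [_ [n _ <-]|x Ax].
  by case: xgetP => [y _ []|].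
exists (f x) => //; case: xgetP => [y _ [Ay fyx]|/(_ x)[]//].
by apply: finj; rewrite ?inE.
Qed.

Lemma finite_set_bounded (T : choiceType) (F : set T) (Q : T -> nat -> Prop) :
  finite_set F -> (forall x, F x -> exists m, Q x m) ->
  (forall x m m', m <= m' -> Q x m -> Q x m') ->
  exists m, forall x, F x -> Q x m.
Proof.
move=> /finite_seqP[s ->] + Qmono.
elim: s => [|y s IHs] Qex; first by exists 0.
have [m Qm] := Qex y (mem_head _ _).
have [x xs|m' Qm'] := IHs; first by apply: Qex; rewrite /= inE xs orbT.
exists (maxn m m') => x; rewrite /= inE => /predU1P[->|xs].
  by apply: Qmono Qm; exact: leq_maxl.
by apply: Qmono (Qm' _ xs); exact: leq_maxr.
Qed.

Lemma open_bigcap_finite (X : topologicalType) (I : choiceType) (D : set I)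
    (f : I -> set X) :
  finite_set D -> (forall i, D i -> open (f i)) ->
  open (\bigcap_(i in D) f i).
Proof.
move=> finD openf; rewrite -[X in open X]setCK setC_bigcap openC.
by apply: closed_bigcup => // i Di; exact/open_closedC/openf.
Qed.

(** The value at [n] may depend on all earlier values; this is how a play of a
    game is generated. *)
Lemma history_recursion (T : Type) (F : seq T -> T) :
  exists V : nat -> T, forall n, V n = F (mkseq V n).
Proof.
pose h n := iter n (fun s => rcons s (F s)) [::].
exists (fun n => F (h n)) => n; congr F.
by elim: n => // n IHn; rewrite mkseqS -IHn.
Qed.

(** The histories up to the current inning are an accumulator, since the move of
    an inning depends on all earlier moves. *)
Fixpoint bounded_plays_from (T : Type) (u : seq T -> nat -> T)
    (L : seq (seq T)) (b : seq nat) : seq (seq T) :=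
  if b is m :: b' then
    bounded_plays_from u [seq rcons h (u h j) | h <- L, j <- iota 0 m] b'
  else L.

(** For [u := fun _ j => j] this is the finite box of index sequences below
    [b]. *)
Definition bounded_plays (T : Type) (u : seq T -> nat -> T) :=
  bounded_plays_from u [:: [::]].

Lemma bounded_plays_rcons (T : eqType) (u : seq T -> nat -> T) b m h j :
  h \in bounded_plays u b -> j < m ->
  rcons h (u h j) \in bounded_plays u (rcons b m).
Proof.
rewrite /bounded_plays; elim: b [:: [::]] => [|m' b IHb] L /= hL jm.
  by apply: allpairs_f; rewrite // mem_iota.
exact: IHb.
Qed.

Lemma bounded_plays_mkseq (T : eqType) (u : seq T -> nat -> T)
    (V : nat -> T) (G J : nat -> nat) i :
  (forall l, l < i -> V l = u (mkseq V l) (J l) /\ J l < G l) ->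
  mkseq V i \in bounded_plays u (mkseq G i).
Proof.
elim: i => [|i IHi] HV; first by rewrite inE.
have [VJ JG] := HV i (leqnn _).
rewrite !mkseqS VJ; apply: bounded_plays_rcons JG; apply: IHi => l li; exact/HV/ltnW.
Qed.

(** Any injective coding of pairs with [n < pair_code n i] would do: the bound
    turns existence for every [n] into existence for arbitrarily large codes. *)
Definition pair_code n i := 2 ^ n * i.*2.+1.

Definition pair_decode m := (logn 2 m, (m %/ 2 ^ logn 2 m)./2).

Lemma pair_codeK n i : pair_decode (pair_code n i) = (n, i).
Proof.
have e : logn 2 (pair_code n i) = n.
  rewrite /pair_code lognM ?expn_gt0// pfactorK// logn_coprime ?addn0//.
  by rewrite coprime2n /= odd_double.
by rewrite /pair_decode e mulKn ?expn_gt0//= uphalf_double.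
Qed.

Lemma pair_code_gt n i : n < pair_code n i.
Proof. by rewrite (leq_trans (ltn_expl n (isT : 1 < 2)))// leq_pmulr. Qed.

(** * The Rothberger game *)

Section Rothberger.
Variable X : topologicalType.
Hypothesis X_nonempty : [set: X] !=set0.
Hypothesis rothberger : S1 (covers X) (covers X).

(** A family in which [X] itself occurs is not a cover in the sense of
    [covers], but then selecting [X] once is enough. *)
Lemma rothberger_select (I : countType) (D : nat -> set I)
    (c : nat -> I -> set X) :
  (forall n i, D n i -> open (c n i)) ->
  (forall n x, exists i, D n i /\ c n i x) ->
  exists s : nat -> I, (forall n, D n (s n)) /\ forall x, exists n, c n (s n) x.
Proof.
move=> openc coverc; have [x0 _] := X_nonempty.
have [s0 s0P] := choice (fun n => coverc n x0).
have [[n [i [Di cX]]]|noX] := pselect (exists n i, D n i /\ c n i = setT).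
  exists (fun m => if m == n then i else s0 m); split=> [m|x].
    by case: eqVneq => [->//|_]; have [] := s0P m.
  by exists n; rewrite eqxx cX.
have [n|V [VP [_ _ Vcov _]]] := rothberger (Us := fun n => c n @` D n).
  split.
  - exact/(sub_countable (card_image_le _ _))/countableP.
  - by move=> _ [i Di <-]; exact: openc.
  - apply/seteqP; split=> // x _; have [i [Di ci]] := coverc n x.
    by exists (c n i) => //; exists i.
  - by move=> [i Di ci]; apply: noX; exists n, i.
have /choice[s sP] : forall n, exists i, D n i /\ c n i = V n.
  by move=> n; have [i Di e] := VP n; exists i.
exists s; split=> [n|x]; first by have [] := sP n.
have : union_of (range V) x by rewrite Vcov.
by move=> [_ [n _ <-] Vx]; exists n; have [_ ->] := sP n.
Qed.

(** Split the sequence into infinitely many subsequences and select a cover of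
    [X] from each. *)
Lemma rothberger_select_infinitely_often (I : countType) (D : nat -> set I)
    (c : nat -> I -> set X) :
  (forall n i, D n i -> open (c n i)) ->
  (forall n x, exists i, D n i /\ c n i x) ->
  exists s : nat -> I, (forall n, D n (s n)) /\
    forall x N, exists2 n, N <= n & c n (s n) x.
Proof.
move=> openc coverc; have [x0 _] := X_nonempty.
have [s0 s0P] := choice (fun n => coverc n x0).
have /choice[s sP] N := rothberger_select
  (fun k => @openc (pair_code N k)) (fun k => coverc (pair_code N k)).
exists (fun m => let: (N, k) := pair_decode m in
  if pair_code N k == m then s N k else s0 m); split=> [m|x N].
  case: (pair_decode m) => N k; case: eqP => [<-|_]; first exact: (sP N).1.
  by have [] := s0P m.
have [k ck] := (sP N).2 x; exists (pair_code N k).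
  exact/ltnW/pair_code_gt.
by rewrite pair_codeK eqxx.
Qed.

(** Hurewicz's theorem on the Menger game, in the form of a branch. Call [m] a
    good reply at [x] to the position [t] if [x] is in [A t m]. The element of
    the [n]th cover given by a sequence [b] consists of the [x] at which, for
    every [l < n], [b l] is a good reply to all positions in the box below [b
    0, ..., b (l - 1)]. Any branch [G] that leaves the box of [b] then gives a
    good reply at [x] at its first exit: up to there [G] is a position in the
    box, and monotonicity in the reply does the rest. The branch [G] is made
    to leave the [n]th selected box at coordinate [n - 1] at the latest. *)
Lemma menger_branch (A : seq nat -> nat -> set X) :
  (forall t m, open (A t m)) ->
  (forall t m m', m <= m' -> A t m `<=` A t m') ->
  (forall t x, exists m, A t m x) ->
  exists G : nat -> nat, (forall i, 0 < G i) /\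
    forall x N, exists2 i, N <= i & A (mkseq G i) (G i) x.
Proof.
move=> openA monoA coverA.
pose box b i := bounded_plays (fun (_ : seq nat) j => j) (mkseq (nth 0 b) i).
pose c n (b : seq nat) :=
  \bigcap_(i in `I_n) \bigcap_(t in [set` box b i]) A t (nth 0 b i).
(* All entries are at least [n], so that first exits from later boxes occur at
   larger values of [G], hence arbitrarily late. *)
pose D n := [set b : seq nat | forall l, l < n -> n <= nth 0 b l].
have [n b _|n x|s [sD sP]] := @rothberger_select_infinitely_often _ D c.
- apply: open_bigcap_finite; first exact: finite_II.
  by move=> i _; exact: open_bigcap_finite (finite_seq _) _.
- pose E (b : seq nat) m := n <= m /\
    forall t, t \in bounded_plays (fun (_ : seq nat) j => j) b -> A t m x.
  have /choice[F FP] : forall b, exists m, E b m.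
    move=> b.
    have [|t _|t m m' mm' /monoA|m mP] := @finite_set_bounded _
      [set` bounded_plays (fun (_ : seq nat) j => j) b]
      (fun t m => A t m x).
    + exact: finite_seq.
    + exact: coverA.
    + exact.
    + exists (maxn n m); split; first exact: leq_maxl.
      by move=> t /mP; apply: monoA; exact: leq_maxr.
  have [b bF] := history_recursion F; exists (mkseq b n); split.
    by move=> l ln; rewrite nth_mkseq// bF; exact: (FP _).1.
  move=> i /= ln t; rewrite /box /= nth_mkseq// bF => tb; apply: (FP _).2.
  congr (_ \in bounded_plays _ _): tb.
  apply/eq_in_map => l; rewrite mem_iota /= => li; apply: nth_mkseq.
  exact: ltn_trans ln.
pose G l := nth 0 (s l.+1) l; exists G; split=> [i|x N].
  by apply: leq_ltn_trans (sD i.+1 i (leqnn _)).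
have [[//|n] nN cx] := sP x (\max_(j < N) G j).+2.
(* [i] is the first exit of [G] from the box of [s n.+1]. *)
have Gex : exists i, nth 0 (s n.+1) i <= G i by exists n.
have Gn : nth 0 (s n.+1) n <= G n by [].
case: (ex_minnP Gex) => i Gi imin.
have iLn : i < n.+1 by rewrite ltnS imin.
exists i.
  rewrite leqNgt; apply/negP => iN.
  have := leq_bigmax (F := fun j : 'I_N => G j) (Ordinal iN) => /= GiM.
  have := sD n.+1 i iLn.
  move: (\max_(j < N) G j) GiM nN Gi => M; lia.
apply: monoA Gi _ _; apply: cx => //=.
apply: (bounded_plays_mkseq (J := G)) => l li; split=> //.
by rewrite ltnNge; apply/negP => /imin; rewrite leqNgt li.
Qed.

(** Here [u h j] is the [j]th possible answer of TWO after the history [h].  Take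
    bounds [G] from [menger_branch]: every [x] is, for infinitely many [k], in the
    set [A k] of points covered by the answers below [G k] in all positions of
    [L k] simultaneously.  A table [J] prescribing an answer in each position of
    [L k] covers the part [O k J] of [A k], and these parts exhaust [A k].  The
    remaining problem is that [x] is in [A k] only for some [k]; it is solved by
    selecting, for each [n], tables for [n + 1] different innings at once, of
    which one can always be given to an inning that has no table yet. *)
Theorem pawlikowski (u : seq (set X) -> nat -> set X) :
  (forall h j, open (u h j)) -> (forall h x, exists j, u h j x) ->
  exists V : nat -> set X, (forall n, exists j, V n = u (mkseq V n) j) /\
    forall x N, exists2 n, N <= n & V n x.
Proof.
move=> openu coveru.
have [t m|t m m' mm'|t x|G [G_gt0 GP]] := @menger_branch (fun t m =>
    \bigcap_(h in [set` bounded_plays u t]) \bigcup_(j in `I_m) u h j).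
- apply: open_bigcap_finite (finite_seq _) _ => h _.
  exact: bigcup_open.
- move=> x Ax h /Ax[j jm ux]; exists j => //=; exact: leq_trans mm'.
- apply: finite_set_bounded (finite_seq _) _ _ => [h _|h m m' mm' [j jm ux]].
    by have [j uj] := coveru h x; exists j.+1, j => /=.
  by exists j => //=; exact: leq_trans mm'.
pose L k := bounded_plays u (mkseq G k).
pose valid k J := forall h, h \in L k -> nth 0 J (index h (L k)) < G k.
pose O k J := \bigcap_(h in [set` L k]) u h (nth 0 J (index h (L k))).
(* A table [J] lists one answer for each position, in the order of [L k].  The
   innings are at least [n], so those used for late [n] are late. *)
pose D n := [set ps : seq (nat * seq nat) | [/\ size ps = n.+1,
  uniq (unzip1 ps) & forall p, p \in ps -> n <= p.1 /\ valid p.1 p.2]].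
pose c (n : nat) (ps : seq (nat * seq nat)) :=
  \bigcap_(p in [set` ps]) O p.1 p.2.
have [n ps _|n x|s [sD sP]] := @rothberger_select_infinitely_often _ D c.
- apply: open_bigcap_finite (finite_seq _) _ => p _.
  exact: open_bigcap_finite (finite_seq _) _.
- suff [ps [psz psu [B psP]]] : exists ps : seq (nat * seq nat),
    [/\ size ps = n.+1, uniq (unzip1 ps) & exists B, forall p, p \in ps ->
       [/\ n <= p.1, p.1 < B, valid p.1 p.2 & O p.1 p.2 x]].
    exists ps; split; last by move=> p /psP[].
    by split=> // p /psP[].
  elim: n.+1 => [|M [ps [psz psu [B psP]]]]; first by exists [::]; split; [| |exists 0].
  have [k Bk Ak] := GP x (maxn n B).
  have [J [Jv OJ]] : exists J, valid k J /\ O k J x.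
    have /choice[f fP] : forall h, exists j, h \in L k -> j < G k /\ u h j x.
      move=> h; have [/Ak[j jG uj]|] := boolP (h \in L k); last by exists 0.
      by exists j.
    have Jf h : h \in L k -> nth 0 [seq f i | i <- L k] (index h (L k)) = f h.
      by move=> hL; rewrite (nth_map [::]) ?index_mem// nth_index.
    exists [seq f i | i <- L k]; split=> h hL.
      by rewrite Jf//; have [] := fP h hL.
    by rewrite /= Jf//; have [] := fP h hL.
  exists ((k, J) :: ps); split=> /=.
  + by rewrite psz.
  + rewrite psu andbT; apply/negP => /mapP[p pps /= kp].
    by have [_ + _ _] := psP p pps; rewrite -kp; lia.
  + exists k.+1 => p; rewrite inE => /predU1P[->/=|/psP[? pB ? ?]].
      by split=> //; lia.
    split=> //; rewrite ltnS (leq_trans (ltnW pB))// (leq_trans _ Bk)//.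
    exact: leq_maxr.
(* Of the [n + 1] innings in [s n], at most [n] were used before. *)
have /choice[F FP] : forall hst : seq (nat * seq nat), exists p,
    p \in s (size hst) /\ p.1 \notin unzip1 hst.
  move=> hst; apply/not_existsP => noF.
  have [sz su _] := sD (size hst).
  have /(uniq_leq_size su) : {subset unzip1 (s (size hst)) <= unzip1 hst}.
    move=> _ /mapP[p ps ->]; apply: contraPT (noF p) => pn; exact.
  by rewrite !size_map sz ltnn.
have [q qF] := history_recursion F.
have qs n : q n \in s n by have [] := FP (mkseq q n); rewrite -qF size_mkseq.
have q_lt m n : m < n -> (q m).1 != (q n).1.
  move=> mn; have [_] := FP (mkseq q n); rewrite -qF.
  apply: contraNneq => <-; apply/map_f/map_f; by rewrite mem_iota.
have q_inj m n : (q m).1 = (q n).1 -> m = n.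
  by move=> e; case: (ltngtP m n) => // /q_lt; rewrite e eqxx.
have /choice[e eP] : forall k, exists J, valid k J /\
    forall n, (q n).1 = k -> J = (q n).2.
  move=> k; have [[n <-]|nok] := pselect (exists n, (q n).1 = k).
    exists (q n).2; split=> [|m /q_inj->//].
    by have [_ _ /(_ _ (qs n))[]] := sD n.
  exists [::]; split=> [h _|n qn]; first by rewrite nth_nil.
  by case: nok; exists n.
pose J k h := nth 0 (e k) (index h (L k)).
(* TWO follows the table of the current inning. *)
have [V VF] := history_recursion (fun h => u h (J (size h) h)).
have VJ n : V n = u (mkseq V n) (J n (mkseq V n)).
  by rewrite {1}VF size_mkseq.
have VL n : mkseq V n \in L n.
  elim: n => [|n IHn]; first by rewrite inE.
  rewrite mkseqS VJ /L mkseqS; apply: bounded_plays_rcons => //.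
  exact: (eP n).1.
exists V; split=> [n|x N]; first by exists (J n (mkseq V n)).
have [n Nn cx] := sP x N.
exists (q n).1.
  by have [_ _ /(_ _ (qs n))[nq _]] := sD n; exact: leq_trans nq.
rewrite VJ /J ((eP _).2 n erefl).
by apply: (cx _ (qs n)); exact: VL.
Qed.

End Rothberger.

(** * Interval and block partitions *)

(** Consecutive intervals [a k <= n < a k.+1], each so long that data attached to
    the indices below its left end are located before its right end. *)
Lemma intervals (nx : nat -> nat) : (forall N, N < nx N) ->
  exists a kappa : nat -> nat,
    [/\ a 0 = 0, forall k, a k.+1 = nx (a k), {homo a : i j / i <= j}
      & forall n k, (kappa n == k) = (a k <= n < a k.+1)].
Proof.
move=> nxP; pose a k := iter k nx 0.
have a_lt k : a k < a k.+1 by exact: nxP.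
have a_le : {homo a : i j / i <= j}.
  by apply: homo_leq => [//|? ? ?|k]; [exact: leq_trans|exact/ltnW].
have /choice[kappa kP] : forall n, exists k, a k <= n < a k.+1.
  move=> n; have ka k : k <= a k.
    by elim: k => // k IHk; exact: leq_ltn_trans (a_lt k).
  have ex : exists k, n < a k.+1 by exists n; exact: leq_trans (ka n.+1).
  case: (ex_minnP ex) => -[|k] nk kmin; first by exists 0; rewrite nk.
  exists k.+1; rewrite nk andbT leqNgt.
  by apply/negP => /kmin; rewrite ltnn.
exists a, kappa; split=> // n k; apply/eqP/idP => [<-//|/andP[kn nk]].
have /andP[kn' nk'] := kP n.
apply/eqP; rewrite eqn_leq; apply/andP; split;
  rewrite leqNgt; apply/negP => /a_le.
  by rewrite leqNgt (leq_ltn_trans kn' nk).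
by rewrite leqNgt (leq_ltn_trans kn nk').
Qed.

Lemma block_partition (T : Type) (V : nat -> T) (beta : nat -> nat)
    (P := range (fun j => V @` (beta @^-1` [set j]))) :
  injective V -> (forall j, finite_set (beta @^-1` [set j])) ->
  (forall j, exists n, beta n = j) ->
  [/\ set_partition P (range V), forall F, P F -> finite_set F
    & infinite_set P].
Proof.
move=> Vinj beta_fin beta_surj; split.
- split.
  + apply/seteqP; split=> [W [F [j _ <-] [n _ <-]]|W [n _ <-]]; first by exists n.
    by exists (V @` (beta @^-1` [set beta n])); [exists (beta n)|exists n].
  + move=> F F' [i _ <-] [j _ <-] [W [[n ni <-] [m mj /Vinj mn]]].
    by rewrite -(ni : beta n = i) -(mj : beta m = j) mn.
  + move=> _ [j _ <-]; have [n nj] := beta_surj j.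
    by exists (V n), n.
- by move=> _ [j _ <-]; exact: finite_image.
- move=> finP; apply: infinite_nat.
  have : finite_set ((fun j => V @` (beta @^-1` [set j])) @^-1` P).
    apply: finite_preimage finP.
    move=> i j _ _ e; have [n ni] := beta_surj i.
    have : (V @` (beta @^-1` [set i])) (V n) by exists n.
    by rewrite e => -[m + /Vinj mn]; rewrite mn /= ni.
  by apply: sub_finite_set => j _; exists j.
Qed.

(** * Large covers *)

Section LargeCovers.
Variable X : topologicalType.
Hypothesis X_nonempty : [set: X] !=set0.

Lemma infinitely_often_infinite (V : nat -> set X) (x : X) : injective V ->
  (forall N, exists2 n, N <= n & V n x) <->
  infinite_set [set W | range V W /\ W x].
Proof.
move=> Vinj; split=> [io fin|inf N].
  have : finite_set (V @^-1` [set W | range V W /\ W x]).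
    by apply: finite_preimage fin => ? ? _ _; exact: Vinj.
  case/(finite_set_bounded (Q := fun n m => n <= m)) => [n _|n m m' mm' nm|M MP].
  - by exists n.
  - exact: leq_trans mm'.
  - by have [n Mn Vn] := io M.+1; have := MP n (conj (imageT _ _) Vn); lia.
apply: contrapT => noN; apply: inf.
apply: sub_finite_set (finite_image V (finite_II N)) => _ [[n _ <-] Vx].
by exists n => //=; rewrite ltnNge; apply/negP => Nn; apply: noN; exists n.
Qed.

(** If only finitely many elements contained [x], a finite set consisting of [x]
    and one point outside each of them would not be contained in any element. *)
Lemma omega_large : omega_covers X `<=` large_covers X.
Proof.
move=> U [Ucov Uomega]; split=> // x fin.
have [_ _ _ UX] := Ucov.
have /choice[y yP] : forall W, exists z, U W -> ~ W z.
  move=> W; apply: contrapT => noz; apply: UX.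
  suff -> : [set: X] = W by apply: contrapT => UW; apply: noz; exists x.
  apply/seteqP; split=> // z _; apply: contrapT => Wz; apply: noz.
  by exists z.
have [|W UW FW] := Uomega (x |` y @` [set W | U W /\ W x]).
  by rewrite finite_setU; split; [exact: finite_set1|exact: finite_image].
have Wx : W x by apply: FW; left.
by apply: (yP W UW); apply: FW; right; exists W.
Qed.

(** A large cover remains a cover after removing the finitely many earlier moves,
    so TWO may avoid repetitions; then being covered in infinitely many innings
    means being in infinitely many elements of the outcome. *)
Lemma rothberger_game_large (tau : seq (set X) -> set (set X)) :
  S1 (covers X) (covers X) -> (forall h, large_covers X (tau h)) ->
  exists V : nat -> set X,
    (forall n, tau (mkseq V n) (V n)) /\ large_covers X (range V).
Proof.
move=> roth tauP.
have fresh h x : exists2 W, (tau h `\` [set` h]) W & W x.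
  have [_ /(_ x) inf] := tauP h; apply: contrapT => noW; apply: inf.
  apply: sub_finite_set (finite_seq h) => W [tW Wx].
  by apply: contrapT => Wh; apply: noW; exists W.
have /choice[u uP] : forall h, exists u : nat -> set X,
    range u = tau h `\` [set` h].
  move=> h; apply: countable_enumeration.
    have [[ctau _ _ _] _] := tauP h.
    by apply: sub_countable ctau; apply: subset_card_le => W [].
  by have [x _] := X_nonempty; have [W tW _] := fresh h x; exists W.
have u_in h j : (tau h `\` [set` h]) (u h j) by rewrite -uP; exists j.
have [h j|h x|V [VP Vio]] := pawlikowski X_nonempty roth (u := u).
- by have [[_ tauO _ _] _] := tauP h; apply: tauO; have [] := u_in h j.
- by have [W] := fresh h x; rewrite -uP => -[j _ <-]; exists j.
have Vin n : (tau (mkseq V n) `\` [set` mkseq V n]) (V n).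
  by have [j ->] := VP n; rewrite /= -/(mkseq V n); exact: u_in.
have Vneq m n : m < n -> V m <> V n.
  move=> mn e; have [_] := Vin n; apply; rewrite -e /=.
  by apply: map_f; rewrite mem_iota.
have Vinj : injective V.
  by move=> m n e; case: (ltngtP m n) => // /Vneq; rewrite e.
exists V; split=> [n|]; first by have [] := Vin n.
split; last by move=> x; apply/infinitely_often_infinite.
split.
- exact/(sub_countable (card_image_le _ _))/countableP.
- move=> _ [n _ <-]; have [[_ tauO _ _] _] := tauP (mkseq V n).
  by apply: tauO; have [] := Vin n.
- apply/seteqP; split=> // x _; have [n _ Vx] := Vio x 0.
  by exists (V n) => //; exists n.
- move=> [n _ VX]; have [[_ _ _ ntau] _] := tauP (mkseq V n).
  by apply: ntau; rewrite -VX; have [] := Vin n.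
Qed.

Lemma large_enumeration U : large_covers X U ->
  exists V : nat -> set X, [/\ injective V, range V = U
    & forall x N, exists2 n, N <= n & V n x].
Proof.
move=> [[ctU _ _ _] Ularge].
have infU : infinite_set U.
  have [x _] := X_nonempty; move=> finU; apply: (Ularge x).
  by apply: sub_finite_set finU => W [].
have /card_esym/card_set_bijP[V [VU Vinj Vsurj]] := eq_card_nat ctU infU.
have Vi : injective V by move=> m n; apply: Vinj; rewrite inE.
have rV : range V = U.
  by apply/seteqP; split=> // _ [n _ <-]; exact: VU.
by exists V; split=> // x; apply/(infinitely_often_infinite _ Vi); rewrite rV.
Qed.

End LargeCovers.

(** * Large covers belong to gimel *)

Section Families.
Variable X : topologicalType.
Variable B : set (set (set X)).
Hypothesis X_nonempty : [set: X] !=set0.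
Hypothesis B_covers : B `<=` covers X.
Hypothesis B_ramseyan : ramseyan B.
Hypothesis B_derefinable : finite_to_one_derefinable B.

(** The two parts form a partition only if both are nonempty. *)
Lemma ramseyan_split (U A : set (set X)) : B U -> B (U `&` A) \/ B (U `\` A).
Proof.
move=> BU.
have [UA0|/set0P UA] := eqVneq (U `&` A) set0.
  right; suff -> : U `\` A = U by [].
  apply/seteqP; split=> [W []//|W UW]; split=> // AW.
  by have : (U `&` A) W by []; rewrite UA0.
have [UD0|/set0P UD] := eqVneq (U `\` A) set0.
  left; suff -> : U `&` A = U by [].
  apply/seteqP; split=> [W []//|W UW]; split=> //; apply: contrapT => AW.
  by have : (U `\` A) W by []; rewrite UD0.
have [||W [->|->]] := B_ramseyan BU (P := [set U `&` A; U `\` A]).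
- split.
  + by rewrite /cover bigcup_setU !bigcup_set1 setUIDK.
  + move=> F F' [->|->] [->|->] // [W [[_ ?] [_ ?]]]//.
  + by move=> F [->|->].
- exact: finite_set2.
- by left.
- by right.
Qed.

(** The positions in the injective enumeration [V] of the large cover locate
    everything.  When no tail from [m0] on has a finite subcover, [Ufin] gives
    [E] in [B], each element [e] of which is contained in the segment of [V] from
    [pos e] to [g (pos e)].  The intervals [a] are long enough for such a segment
    to end in the interval after the one in which it starts, and for each
    interval to contain the position of some [far N].  That element has a point
    outside the segment from [m0] to [N], so different blocks have different
    unions, with the possible exception of the first block, which contains the
    part of [V] before [m0].  This makes the passage from [e] to the union of its
    block finite-to-one. *)
Lemma large_sub_gimel : Ufin (covers X) B -> large_covers X `<=` gimel B.
Proof.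
move=> ufin U Ularge; have [Ucov _] := Ularge.
have [V [Vinj rV Vio]] := large_enumeration X_nonempty Ularge.
have [_ VO _ VnX] : covers X (range V) by rewrite rV.
have openV n : open (V n) by apply: VO; exists n.
have Vneq n : V n <> setT by move=> e; apply: VnX; rewrite -e; exists n.
rewrite -rV in Ucov *; split=> //.
pose seg m p := \bigcup_(n in [set n | m <= n < p]) V n.
have seg_mono m m' p p' : m' <= m -> p <= p' -> seg m p `<=` seg m' p'.
  by move=> mm pp x [n /= mnp Vx]; exists n => //=; lia.
have [allX|] := pselect (forall m, exists p, seg m p = setT).
  left; split=> //.
  have /choice[nx nxP] : forall m, exists p, m < p /\ seg m p = setT.
    move=> m; have [p pX] := allX m; exists p; split=> //.
    have [x _] := X_nonempty; have : seg m p x by rewrite pX.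
    by case=> n /=; lia.
  have [a [kappa [a0 aS a_le kP]]] := intervals (fun N => (nxP N).1).
  have fibE k : kappa @^-1` [set k] = [set n | a k <= n < a k.+1].
    apply/seteqP; split=> n /=; first by rewrite -kP => ->.
    by rewrite -kP => /eqP.
  have finfib k : finite_set (kappa @^-1` [set k]).
    rewrite fibE; apply: sub_finite_set (finite_II (a k.+1)) => n /=.
    by case/andP.
  have surj k : exists n, kappa n = k.
    exists (a k); apply/eqP; rewrite kP leqnn /= aS; exact: (nxP _).1.
  have [Ppart Pfin Pinf] := block_partition Vinj finfib surj.
  eexists; split; [exact: Ppart|exact: Pinf|] => F PF; split; first exact: Pfin.
  have FX : finite_set F by exact: Pfin.
  case: PF => k _ <- {F FX}; split.
  - exact/finite_set_countable/finite_image.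
  - by move=> _ [n _ <-].
  - rewrite /union_of bigcup_image fibE -/(seg _ _) aS; exact: (nxP _).2.
  - by move=> [n _ /Vneq].
move=> /existsNP[m0 /forallNP noX].
right.
pose Us m := V @` [set n | m0 + m <= n].
have bounded_union m (F : set (set X)) : F `<=` Us m -> finite_set F ->
    exists p, union_of F `<=` seg (m0 + m) p.
  move=> FU finF.
  have [W FW|W p p' pp' + x|p pP] := finite_set_bounded
    (Q := fun W p => W `<=` seg (m0 + m) p) finF.
  - have [n /= mn <-] := FU W FW; exists n.+1 => x Vx; exists n => //=.
    by rewrite mn leqnn.
  - by move=> /(_ x) + Wx => /(_ Wx); exact: seg_mono.
  - by exists p => x [W FW Wx]; exact: pP Wx.
have UsP m : covers X (Us m) /\ ~ has_finite_subcover (Us m).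
  split; first split.
  - exact/(sub_countable (card_image_le _ _))/countableP.
  - by move=> _ [n _ <-].
  - apply/seteqP; split=> // x _; have [n mn Vx] := Vio x (m0 + m).
    by exists (V n) => //; exists n.
  - by move=> [n _ /Vneq].
  move=> [F [FU finF [_ _ FX _]]]; have [p] := bounded_union _ _ FU finF.
  rewrite FX => pX; apply: (noX p); apply/seteqP; split=> // x _.
  by apply: seg_mono (pX x I) => //; exact: leq_addr.
have [Fs [FsP BE]] := ufin Us UsP.
pose E := range (fun m => union_of (Fs m)); rewrite -/E in BE.
have [_ EO EX EnX] := B_covers BE.
have /choice[g gP] : forall n, exists p, m0 <= n ->
    union_of (Fs (n - m0)) `<=` seg n p.
  move=> n; have [FU finF] := FsP (n - m0).
  have [p pP] := bounded_union _ _ FU finF.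
  by exists p => mn; rewrite subnKC in pP.
have /choice[pos posP] : forall e, exists n, E e ->
    m0 <= n /\ e = union_of (Fs (n - m0)).
  move=> e; have [[m _ <-]|?] := pselect (E e); last by exists 0.
  by exists (m0 + m) => _; rewrite leq_addr addKn.
have e_seg e : E e -> e `<=` seg (pos e) (g (pos e)).
  by move=> /posP[mn {1}->]; exact: gP.
have pos_fin N : finite_set [set e | E e /\ pos e < N].
  apply: sub_finite_set
    (finite_image (fun n => union_of (Fs (n - m0))) (finite_II N)).
  by move=> e [/posP[_ {2}->] eN]; exists (pos e).
have gmax N : exists M, N <= M /\ forall n, n < N -> g n <= M.
  exists (N + \max_(n < N) g n); split=> [|n nN]; first exact: leq_addr.
  apply: leq_trans (leq_addl _ _).
  exact: (leq_bigmax (F := fun n : 'I_N => g n) (Ordinal nN)).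
have seg_proper p : exists x, ~ seg m0 p x.
  apply/existsNP => allx; apply: (noX p); apply/seteqP.
  by split=> // x _; exact: allx.
have E_far N : exists e, [/\ E e, N <= pos e & exists x, e x /\ ~ seg m0 N x].
  have [M [NM gM]] := gmax N.
  have [x xM] := seg_proper M.
  have [e Ee ex] : union_of E x by rewrite EX.
  exists e; split=> //; last first.
    by exists x; split=> // /(seg_mono _ _ _ _ (leqnn m0) NM).
  rewrite leqNgt; apply/negP => eN; apply: xM.
  have [m0e _] := posP e Ee.
  exact: seg_mono m0e (gM _ eN) _ (e_seg _ Ee _ ex).
have /choice[far farP] := E_far.
have /choice[nx nxP] : forall N, exists M,
    [/\ N < M, m0 < M, pos (far N) < M & forall n, n < N -> g n <= M].
  move=> N; have [M [NM gM]] := gmax N; exists (M + m0 + pos (far N)).+1.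
  by split; try lia; move=> n /gM; lia.
have [|a [kappa [a0 aS a_le kP]]] := @intervals nx; first by move=> N; case: (nxP N).
have kappaP n : a (kappa n) <= n < a (kappa n).+1 by rewrite -kP.
have kappa_le n k : n < a k.+1 -> kappa n <= k.
  move=> nk; rewrite leqNgt; apply/negP => /a_le.
  by have /andP[+ _] := kappaP n; lia.
have kappa_ge n k : a k <= n -> k <= kappa n.
  move=> nk; rewrite leqNgt; apply/negP => /a_le.
  by have /andP[_ +] := kappaP n; lia.
(* Keep the elements that start in intervals of one parity [p]. *)
have [p Bp] : exists p : bool, B [set e | E e /\ odd (kappa (pos e)) = p].
  have [BA|BA] := ramseyan_split [set e | odd (kappa (pos e))] BE.
    by exists true.
  exists false; congr B: BA; apply/seteqP; split=> e /= [Ee o]; split=> //.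
    exact/negbTE/negP.
  by rewrite o.
pose Ep := [set e | E e /\ odd (kappa (pos e)) = p]; rewrite -/Ep in Bp.
(* Block [j] consists of the intervals [2j + p] and [2j + p + 1]; when [p] is
   true, the truncated subtraction puts interval 0 into block 0. *)
pose beta n := (kappa n - p)./2.
pose block j := union_of (V @` (beta @^-1` [set j])).
have blockP j x : block j x <-> exists2 n, beta n = j & V n x.
  rewrite /block /union_of bigcup_image; split=> -[n nj Vx]; by exists n.
have beta_lt n j : beta n <= j -> n < a j.*2.+3.
  move=> nj; have /andP[_ nk] := kappaP n; apply: leq_trans nk (a_le _ _ _).
  by move: nj; rewrite /beta; case: p {Bp Ep block blockP beta} => /=; lia.
have Ep_block e : Ep e -> e `<=` block (beta (pos e)).
  move=> [Ee pe] x /(e_seg _ Ee)[n /= /andP[en ng] Vx].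
  apply/blockP; exists n => //.
  have kn : kappa (pos e) <= kappa n.
    by apply: kappa_ge; have /andP[] := kappaP (pos e); lia.
  have kn' : kappa n <= (kappa (pos e)).+1.
    apply: kappa_le; rewrite aS; have [_ _ _ gnx] := nxP (a (kappa (pos e)).+1).
    apply: leq_trans ng (gnx _ _).
    by have /andP[] := kappaP (pos e).
  by move: pe kn kn'; rewrite /beta; lia.
have hit j : Ep (far (a (j.*2 + p))) /\ beta (pos (far (a (j.*2 + p)))) = j.
  set k := j.*2 + p; have [Ee ge_e _] := farP (a k).
  have ke : kappa (pos (far (a k))) = k.
    apply/eqP; rewrite kP ge_e aS /=; by have [] := nxP (a k).
  rewrite /Ep /beta /= ke /k addnK doubleK oddD odd_double; split=> //.
  by split=> //; case: (p).
have block_inj i j : 0 < i -> i < j -> block i <> block j.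
  move=> i0 ij bij; have [[Ee _] ej] := hit j.
  have [_ _ [x [ex xseg]]] := farP (a (j.*2 + p)).
  have : block i x by rewrite bij -ej; apply: Ep_block => //; apply: (hit j).1.
  move=> /blockP[n ni Vx]; apply: xseg; exists n => //=; apply/andP; split.
    have [_ m0a _ _] := nxP (a 0); rewrite -aS in m0a.
    apply: leq_trans (ltnW m0a) _.
    have /andP[an _] := kappaP n; apply: leq_trans an; apply: a_le.
    by move: i0; rewrite -ni /beta; lia.
  rewrite ltnNge; apply/negP => /kappa_ge kn.
  by move: ij; rewrite -ni /beta; lia.
have block_fin W : finite_set [set e | Ep e /\ block (beta (pos e)) = W].
  have [J JP] : exists J, forall j, block j = W -> j <= J.
    have [[j [j0 jW]]|nj] := pselect (exists j, 0 < j /\ block j = W).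
      exists j => i iW; rewrite leqNgt; apply/negP => ji.
      by apply: (block_inj _ _ j0 ji); rewrite iW.
    exists 0 => j jW; rewrite leqNgt; apply/negP => j0.
    by apply: nj; exists j.
  apply: sub_finite_set (pos_fin (a J.*2.+3)) => e [[Ee _] /JP eJ].
  by split=> //; exact: beta_lt.
(* [gimel] discards unions equal to [X], so the finitely many elements whose
   block covers [X] are removed; no finite part of [E] covers [X], so the rest
   stays in [B]. *)
have BE' : B (Ep `\` [set e | block (beta (pos e)) = setT]).
  have [/B_covers[_ _ SX _]|//] :=
    ramseyan_split [set e | block (beta (pos e)) = setT] Bp.
  have [e [[Ee _] _]|e q q' qq' + x|q qP] := finite_set_bounded
    (Q := fun e q => e `<=` seg m0 q) (block_fin setT).
  - exists (g (pos e)) => x ex; have [m0e _] := posP e Ee.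
    exact: seg_mono m0e (leqnn _) _ (e_seg _ Ee _ ex).
  - by move=> /(_ x) + Wx => /(_ Wx); exact: seg_mono.
  - have [x xq] := seg_proper q.
    have [e Se ex] : union_of (Ep `&` [set e | block (beta (pos e)) = setT]) x.
      by rewrite SX.
    by case: xq; exact: qP ex.
have beta_fin j : finite_set (beta @^-1` [set j]).
  apply: sub_finite_set (finite_II (a j.*2.+3)) => n /= nj.
  by apply: beta_lt; rewrite nj.
have beta_surj j : exists n, beta n = j by eexists; exact: (hit j).2.
have [Ppart Pfin _] := block_partition Vinj beta_fin beta_surj.
eexists; split; [exact: Ppart|exact: Pfin|].
apply: (B_derefinable BE').
  split.
  - apply: (@sub_countable _ _ _ (@union_of X @`
        range (fun j => V @` (beta @^-1` [set j])))).
      by apply: subset_card_le => W [].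
    apply: sub_countable (card_image_le _ _) _.
    exact/(sub_countable (card_image_le _ _))/countableP.
  - move=> _ [[_ [j _ <-] <-] _].
    by apply: bigcup_open => _ [n _ <-].
  - apply/seteqP; split=> // x _.
    have [_ _ E'X _] := B_covers BE'.
    have [e [Ee eX] ex] : union_of (Ep `\` [set e | block (beta (pos e)) = setT]) x.
      by rewrite E'X.
    exists (block (beta (pos e))); last exact: Ep_block ex.
    by split=> //; exists (V @` (beta @^-1` [set beta (pos e)])) => //; exists (beta (pos e)).
  - by move=> [_]; apply.
exists (fun e => block (beta (pos e))); split.
- apply/seteqP; split=> [_ [e [Ee eX] <-]|_ [[_ [j _ <-] <-] jX]].
    by split=> //; exists (V @` (beta @^-1` [set beta (pos e)])) => //; exists (beta (pos e)).
  have [Eh hj] := hit j.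
  exists (far (a (j.*2 + p))); last by rewrite hj.
  by split=> //; rewrite /= hj.
- by move=> W _; apply: sub_finite_set (block_fin W) => e [[]].
- by move=> e [Ee _]; exact: Ep_block.
Qed.

End Families.

(** * Omega-covers, the game and partition relations *)

Lemma nsubsets2P (T : pointedType) (D s : set T) :
  nsubsets D 2 s <-> exists x y, [/\ D x, D y, x <> y & s = [set x; y]].
Proof.
split=> [[sD /card_esym]|[x [y [Dx Dy xy ->]]]].
  move=> /card_set_bijP[f [fs finj fsurj]].
  exists (f 0), (f 1); split; [exact/sD/fs|exact/sD/fs| |].
    by move=> /finj; rewrite !inE => /(_ isT isT).
  apply/seteqP; split=> [_ /fsurj[[|[|//]] _ <-]|_ [->|->]].
  - by left.
  - by right.
  - exact: fs.
  - exact: fs.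
split; first by move=> _ [->|->].
apply: card_esym; apply/card_set_bijP; exists (fun i => if i == 0 then x else y); split.
- by move=> [|i] _; [left|right].
- move=> i j; rewrite !inE /=.
  by case: i => [|[|i]] //; case: j => [|[|j]] //= _ _ e; case: xy.
- by move=> _ [->|->]; [exists 0|exists 1].
Qed.

Section OmegaCovers.
Variable X : topologicalType.

Lemma sub_omega (U U' : set (set X)) : omega_covers X U -> U' `<=` U ->
  (forall F : set X, finite_set F -> exists2 W, U' W & F `<=` W) ->
  omega_covers X U'.
Proof.
move=> [[ctU UO _ UX] _] U'U U'omega; split=> //; split.
- exact: sub_countable (subset_card_le U'U) ctU.
- exact: subset_trans U'U UO.
- apply/seteqP; split=> // x _.
  have [W U'W xW] := U'omega _ (finite_set1 x).
  by exists W => //; exact: xW.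
- by move=> /U'U.
Qed.

(** If each colour class misses a finite set, the union of these sets is
    contained in no element. *)
Lemma omega_ramsey (K : finType) (g : set X -> K) (U : set (set X)) :
  omega_covers X U -> exists c, omega_covers X (U `&` [set W | g W = c]).
Proof.
move=> Uomega; apply: contrapT => /forallNP noc.
have /choice[F FP] : forall c, exists F : set X, finite_set F /\
    forall W, U W -> g W = c -> ~ F `<=` W.
  move=> c; apply: contrapT => noF; apply: (noc c).
  apply: sub_omega Uomega _ _ => [W []//|F finF].
  apply: contrapT => noW; apply: noF; exists F; split=> // W UW gW FW.
  by apply: noW; exists W.
have [_ /(_ (\bigcup_c F c))[|W UW FW]] := Uomega.
  by apply: bigcup_finite => // c _; exact: (FP c).1.
apply: ((FP (g W)).2 W UW erefl) => x Fx.
by apply: FW; exists (g W).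
Qed.

(** Beating all strategies that are defined on arbitrary histories is enough:
    a strategy may be changed to a fixed move after the histories for which it
    leaves [A], and a sequence of covers is a strategy that ignores the moves
    of TWO. *)
Lemma S1_and_no_winning_strategy (A C : set (set (set X))) :
  (forall tau, (forall h, A (tau h)) -> exists V : nat -> set X,
    (forall n, tau (mkseq V n) (V n)) /\ C (range V)) ->
  S1 A C /\ ~ ONE_wins_G1 A C.
Proof.
move=> game; split=> [Us UsA|[sigma [sigmaA sigma_wins]]].
  have [h|V [VP CV]] := game (fun h => Us (size h)); first exact: UsA.
  exists V; split=> // n; by have := VP n; rewrite size_mkseq.
have A0 : A (sigma [::]) by apply: (sigmaA (fun=> setT) 0).
pose tau h := if pselect (A (sigma h)) then sigma h else sigma [::].
have [|V [VP CV]] := game tau.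
  by move=> h; rewrite /tau; case: pselect.
suff legal n : legal_moves_TWO sigma V n by exact: sigma_wins legal CV.
elim: n => [//|n IHn] m; rewrite ltnS leq_eqVlt => /predU1P[->|/IHn//].
by have := VP n; rewrite /tau; case: pselect => // nA; case: nA; exact: sigmaA.
Qed.

(** Enumerate the omega-cover as [u] and choose omega-covers [T n], decreasing in
    [n], such that the colour [kappa (u n)] of the pair of [u n] and [W] is the
    same for all [W] in [T n.+1].  Some colour [j] is taken by [kappa] on an
    omega-cover inside every [T m]: otherwise each colour fails from some index
    on, contradicting [omega_ramsey] beyond all these indices.  If ONE plays the
    elements of colour [j] in [T m], with [m] beyond the indices of all earlier
    moves of TWO, all pairs of moves of TWO have colour [j]. *)
Lemma arrows_of_no_winning_strategy (C : set (set (set X))) k :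
  ~ ONE_wins_G1 (omega_covers X) C -> arrows (omega_covers X) C 2 k.
Proof.
move=> noWin U Uomega f.
have [[ctU _ _ _] Ufin] := Uomega.
have [u rU] : exists u : nat -> set X, range u = U.
  apply: countable_enumeration ctU _.
  by have [W UW _] := Ufin _ (finite_set0 _); exists W.
have /choice[col colP] : forall TW : set (set X) * set X, exists c,
    omega_covers X TW.1 ->
    omega_covers X (TW.1 `&` [set W | f [set TW.2; W] = c]).
  move=> [T W] /=; have [Tomega|?] := pselect (omega_covers X T); last first.
    by exists (f set0).
  by have [c Tc] := omega_ramsey (fun W' => f [set W; W']) Tomega; exists c.
pose fix T n := if n is m.+1 then
  T m `&` [set W | f [set u m; W] = col (T m, u m)] else U.
have Tomega n : omega_covers X (T n).
  by elim: n => [|n IHn]; [exact: Uomega|exact: (colP (T n, u n)) IHn].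
have Tsub m n : m <= n -> T n `<=` T m.
  elim: n => [|n IHn]; first by rewrite leqn0 => /eqP->.
  by rewrite leq_eqVlt => /predU1P[->//|/IHn Tm W [/Tm]].
have /choice[nu nuP] : forall W, exists n, U W -> u n = W.
  move=> W; have [|?] := pselect (U W); last by exists 0.
  by rewrite -rU => -[n _ <-]; exists n.
pose kappa W := col (T (nu W), u (nu W)).
have [j jP] : exists j, forall m, omega_covers X (T m `&` [set W | kappa W = j]).
  apply: contrapT => /forallNP noj.
  have /choice[M MP] : forall j, exists m,
      ~ omega_covers X (T m `&` [set W | kappa W = j]).
    by move=> j; apply/existsNP/noj.
  have [j jP] := omega_ramsey kappa (Tomega (\max_j M j)).
  apply: (MP j); apply: sub_omega (Tomega (M j)) _ _ => [W []//|F finF].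
  have [_ /(_ F finF)[W [TW jW] FW]] := jP; exists W => //; split=> //.
  by apply: Tsub TW; exact: leq_bigmax.
pose sigma (h : seq (set X)) :=
  T (\max_(W <- h) (nu W).+1) `&` [set W | kappa W = j].
have [V [Vlegal CV]] : exists V, (forall n, legal_moves_TWO sigma V n) /\ C (range V).
  apply: contrapT => noV; apply: noWin; exists sigma; split=> [V n _|V Vl CV].
    exact: jP.
  by apply: noV; exists V.
have Vsigma n : sigma (mkseq V n) (V n) by exact: (Vlegal n.+1).
have VU : range V `<=` U.
  by move=> _ [n _ <-]; have [/(Tsub _ _ (leq0n _))] := Vsigma n.
have Vcol m n : m < n -> f [set V m; V n] = j.
  move=> mn; have [TV _] := Vsigma n.
  have [_ fVn] : T (nu (V m)).+1 (V n).
    apply: Tsub TV; apply: (leq_bigmax_seq (F := fun W => (nu W).+1)) => //.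
    by apply: map_f; rewrite mem_iota.
  have : f [set u (nu (V m)); V n] = kappa (V m) by [].
  have uVm : u (nu (V m)) = V m by apply/nuP/VU; exists m.
  by rewrite uVm => ->; have [] := Vsigma m.
exists (range V); split=> //; exists j => s /nsubsets2P[_ [_ [[m _ <-] [n _ <-]]]].
move=> Vmn ->; case: (ltngtP m n) => [/Vcol//|/Vcol|mn]; first by rewrite setUC.
by case: Vmn; rewrite mn.
Qed.

End OmegaCovers.

(** * Back from gimel to covers *)

Section Dispersed.
Variable X : topologicalType.
Variable C : set (set (set X)).

(** The common weakening of [S1 (omega_covers X) C] and of the partition
    relation: [nu] assigns the elements of [V] to different covers, but an element
    need only be contained in an element of its cover, and covers may be left
    out. *)
Definition dispersed_selection := forall Us : nat -> set (set X),
  (forall n, omega_covers X (Us n)) ->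
  exists (V : set (set X)) (nu : set X -> nat),
    [/\ C V, {in V &, injective nu}
      & forall W, V W -> exists2 U, Us (nu W) U & W `<=` U].

(** A set selected several times is assigned to one of its indices. *)
Lemma dispersed_of_S1 : S1 (omega_covers X) C -> dispersed_selection.
Proof.
move=> sel Us UsP; have [V [VP CV]] := sel Us UsP.
have /choice[nu nuP] : forall W, exists n, range V W -> V n = W.
  move=> W; have [[n _ <-]|?] := pselect (range V W); last by exists 0.
  by exists n.
exists (range V), nu; split=> // [W W'|W /nuP VW].
  by rewrite !inE => /nuP {2}<- /nuP {2}<- ->.
by exists W => //; rewrite -[X in Us _ X]VW.
Qed.

(** Let [A] enumerate the cover number 0 and consider the omega-cover of all
    intersections of [A n] with an element of the cover number [n].  Colour a
    pair according to whether both come from the same [n].  A homogeneous set of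
    the first kind lies below a single [A n], so it is no cover of [X]; one of
    the second kind is dispersed. *)
Lemma dispersed_of_arrows : C `<=` covers X ->
  arrows (omega_covers X) C 2 2 -> dispersed_selection.
Proof.
move=> Ccov arr Us UsP.
have [[ct0 O0 _ X0] omega0] := UsP 0.
have [A rA] : exists A : nat -> set X, range A = Us 0.
  apply: countable_enumeration ct0 _.
  by have [W UW _] := omega0 _ (finite_set0 _); exists W.
have UA n : Us 0 (A n) by rewrite -rA; exists n.
pose U := \bigcup_n [set A n `&` W | W in Us n].
have Uomega : omega_covers X U.
  have Ufin (F : set X) : finite_set F -> exists2 W, U W & F `<=` W.
    move=> finF; have [W0] := omega0 _ finF; rewrite -rA => -[n _ <-] FA.
    have [W UW FW] := (UsP n).2 _ finF.
    exists (A n `&` W); first by exists n => //; exists W.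
    by move=> x Fx; split; [exact: FA|exact: FW].
  split=> //; split.
  - apply: bigcup_countable => // n _.
    by apply: sub_countable (card_image_le _ _) _; have [[]] := UsP n.
  - move=> _ [n _ [W UW <-]]; apply: openI; first exact: O0.
    by have [[_ + _ _] _] := UsP n; apply.
  - apply/seteqP; split=> // x _; have [W UW xW] := Ufin _ (finite_set1 x).
    by exists W => //; exact: xW.
  - move=> [n _ [W _ AW]]; apply: X0; suff <- : A n = setT by [].
    by apply/seteqP; split=> // x _; have [] : (A n `&` W) x by rewrite AW.
have /choice[nu nuP] : forall W', exists n, U W' ->
    W' `<=` A n /\ exists2 W, Us n W & W' `<=` W.
  move=> W'; have [[n _ [W UW <-]]|?] := pselect (U W'); last by exists 0.
  by exists n => _; split=> [x []//|]; exists W => // x [].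
pose f (s : set (set X)) : 'I_2 :=
  if `[< exists n, forall W, s W -> nu W = n >] then ord0 else ord_max.
have [V [VU CV [c cP]]] := arr U Uomega f.
exists V, nu; split=> // [|W /VU/nuP[]//] W W'; rewrite !inE => VW VW' e.
apply: contrapT => WW'; have [_ _ VX _] := Ccov _ CV.
apply: X0; suff <- : A (nu W) = setT by [].
apply/seteqP; split=> // x _; have [W1 VW1 W1x] : union_of V x by rewrite VX.
suff <- : nu W1 = nu W by have [+ _] := nuP _ (VU _ VW1); apply.
have [-> //|W1W] := pselect (W1 = W).
(* The pair [W, W'] has equal indices, hence so does the pair [W1, W]. *)
have f1 := cP _ (iffRL (nsubsets2P _ _) (ex_intro _ W (ex_intro _ W'
  (And4 VW VW' WW' erefl)))).
have f2 := cP _ (iffRL (nsubsets2P _ _) (ex_intro _ W1 (ex_intro _ W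
  (And4 VW1 VW W1W erefl)))).
move: f2; rewrite -f1 /f [X in _ = if X then _ else _]asboolT; last first.
  by exists (nu W) => _ [->|->].
case: asboolP => // -[n nP] _.
by rewrite (nP W1 (or_introl erefl)) (nP W (or_intror erefl)).
Qed.

End Dispersed.

Lemma cover_enumeration (X : topologicalType) (Us : nat -> set (set X)) :
  [set: X] !=set0 -> (forall n, covers X (Us n)) ->
  exists u : nat -> nat -> set X, forall n, range (u n) = Us n.
Proof.
move=> [x _] UsP.
have /choice[u uP] : forall n, exists v : nat -> set X, range v = Us n.
  move=> n; have [ctU _ UX _] := UsP n; apply: countable_enumeration ctU _.
  have [W UW _] : union_of (Us n) x by rewrite UX.
  by exists W.
by exists u.
Qed.

Section FromDispersed.
Variable X : topologicalType.
Hypothesis X_nonempty : [set: X] !=set0.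

(** Divide the given covers into infinitely many infinite blocks.  Finite unions
    with one summand from each of the first covers of block [n] form an
    omega-cover, unless such a union is [X], in which case its
    summands already cover [X].  Dispersion means that at most one union is used for each block, so its
    summands can be selected simultaneously. *)
Lemma rothberger_of_dispersed (C : set (set (set X))) : C `<=` covers X ->
  dispersed_selection C -> S1 (covers X) (covers X).
Proof.
move=> Ccov disp Us UsP; have [x0 _] := X_nonempty.
have [u uP] := cover_enumeration X_nonempty UsP.
have u_in n i : Us n (u n i) by rewrite -uP; exists i.
have /choice[pick pickP] : forall mx : nat * X, exists i, u mx.1 i mx.2.
  move=> [m x]; have [_ _ UX _] := UsP m.
  have [W] : union_of (Us m) x by rewrite UX.
  by rewrite -uP => -[i _ <-]; exists i.
pose c n s := \bigcup_(i in `I_(size s)) u (pair_code n i) (nth 0 s i).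
have openc n s : open (c n s).
  apply: bigcup_open => i _; have [_ + _ _] := UsP (pair_code n i); exact.
have [t tP] : exists t : nat -> seq nat, forall x, exists n, c n (t n) x.
  have [[n [s cX]]|noX] := pselect (exists n s, c n s = setT).
    by exists (fun=> s) => x; exists n; rewrite cX.
  have [n|V [nu [CV nu_inj VP]]] := disp (fun n => range (c n)).
    have comega (F : set X) : finite_set F -> exists2 W, range (c n) W & F `<=` W.
      move=> /finite_seqP[xs ->].
      pose s := mkseq (fun i => pick (pair_code n i, nth x0 xs i)) (size xs).
      exists (c n s); first by exists s.
      move=> x /= xxs; have ixs : index x xs < size xs by rewrite index_mem.
      exists (index x xs); first by rewrite /= size_mkseq.
      by rewrite nth_mkseq// nth_index//; exact: (pickP (_, x)).
    split=> //; split.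
    - exact/(sub_countable (card_image_le _ _))/countableP.
    - by move=> _ [s _ <-].
    - apply/seteqP; split=> // x _; have [W cW xW] := comega _ (finite_set1 x).
      by exists W => //; exact: xW.
    - by move=> [s _ cX]; apply: noX; exists n, s.
  have /choice[t tP] : forall n, exists s, forall W, V W -> nu W = n -> W `<=` c n s.
    move=> n; have [[W [VW <-]]|nW] := pselect (exists W, V W /\ nu W = n).
      have [_ [s _ <-] Ws] := VP W VW; exists s => W' VW' e.
      by rewrite (nu_inj W' W) ?inE.
    by exists [::] => W VW e; case: nW; exists W.
  exists t => x; have [_ _ VX _] := Ccov _ CV.
  have [W VW Wx] : union_of V x by rewrite VX.
  by exists (nu W); exact: tP Wx.
pose V m := let: (n, i) := pair_decode m in u m (nth 0 (t n) i).
exists V; split=> [m|]; first by rewrite /V; case: pair_decode.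
have V_in m : Us m (V m) by rewrite /V; case: pair_decode.
split.
- exact/(sub_countable (card_image_le _ _))/countableP.
- by move=> _ [m _ <-]; have [_ + _ _] := UsP m; apply.
- apply/seteqP; split=> // x _; have [n [i _ ux]] := tP x.
  exists (V (pair_code n i)); first by exists (pair_code n i).
  by rewrite /V pair_codeK.
- by move=> [m _ VX]; have [_ _ _] := UsP m; apply; rewrite -VX.
Qed.

(** Choose [K n] one after the other, each time together with a point outside
    [al n (K n)] that all later sets have to contain. *)
Lemma separated_bounds (al : nat -> nat -> set X) (K0 : nat -> nat) :
  (forall n, {homo al n : k k' / k <= k' >-> k `<=` k'}) ->
  (forall n x, exists k, al n k x) -> (forall n k, al n k <> setT) ->
  exists K, (forall n, K0 n <= K n) /\ injective (fun n => al n (K n)).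
Proof.
move=> al_mono al_cover al_proper.
have /choice[F FP] : forall h : seq (nat * X), exists Kz : nat * X,
    [/\ K0 (size h) <= Kz.1, forall p, p \in h -> al (size h) Kz.1 p.2
      & ~ al (size h) Kz.1 Kz.2].
  move=> h; have [//|p k k' kk' /(al_mono _ _ _ kk')//|k kP] :=
    finite_set_bounded (Q := fun p k => al (size h) k p.2) (finite_seq h).
  have [z zP] : exists z, ~ al (size h) (maxn (K0 (size h)) k) z.
    apply/existsNP => allz; apply: (@al_proper (size h) (maxn (K0 (size h)) k)).
    by apply/seteqP; split=> // z _; exact: allz.
  exists (maxn (K0 (size h)) k, z); split=> //=; first exact: leq_maxl.
  by move=> p /kP; apply: al_mono; exact: leq_maxr.
have [V VF] := history_recursion F.
have VP n : [/\ K0 n <= (V n).1, forall m, m < n -> al n (V n).1 (V m).2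
    & ~ al n (V n).1 (V n).2].
  have := FP (mkseq V n); rewrite -VF size_mkseq => -[? VPn ?]; split=> // m mn.
  by apply: VPn; apply: map_f; rewrite mem_iota.
exists (fun n => (V n).1); split=> [n|]; first by have [] := VP n.
have neq m n : m < n -> al m (V m).1 <> al n (V n).1.
  move=> mn e; have [_ _] := VP m; rewrite e; apply.
  by have [_ + _] := VP n; apply.
by move=> m n e; case: (ltngtP m n) => // /neq; rewrite e.
Qed.

(** With [al n k] the union of the first [k] elements of the [n]th cover, the
    sets [b n k], intersections of [al m k] over [m <= n], form omega-covers
    whose elements lie in finite unions from every earlier cover. In
    particular no finite part of the resulting [V] covers [X], so [V] is not
    multifinite, and a partition [P] of [V] with unions [E] in [B] is
    obtained. An element [e] of [E] with least index [rho e] can be enlarged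
    to a finite union from any cover up to [rho e]. It remains to use every
    cover: collapsing intervals that all contain some [rho e] turns [rho] into
    a finite-to-one surjection that only decreases indices, and
    [separated_bounds] keeps the enlarged sets distinct, so that they form a
    finite-to-one derefinement of [E]. *)
Lemma Ufin_of_dispersed (B : set (set (set X))) : B `<=` covers X ->
  finite_to_one_derefinable B -> dispersed_selection (gimel B) ->
  Ufin (covers X) B.
Proof.
move=> B_covers B_derefinable disp Us UsP.
have UsC n := (UsP n).1.
have [u uP] := cover_enumeration X_nonempty UsC.
have u_in n i : Us n (u n i) by rewrite -uP; exists i.
have u_open n i : open (u n i) by have [_ + _ _] := UsC n; exact.
pose al n k := \bigcup_(i in `I_k) u n i.
have al_mono n k k' : k <= k' -> al n k `<=` al n k'.
  by move=> kk' x [i /= ik ux]; exists i => //=; exact: leq_trans kk'.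
have al_cover n x : exists k, al n k x.
  have [_ _ UX _] := UsC n; have [W] : union_of (Us n) x by rewrite UX.
  by rewrite -uP => -[i _ <-] ux; exists i.+1, i => /=.
have al_open n k : open (al n k) by exact: bigcup_open.
have al_union n k : union_of (u n @` `I_k) = al n k.
  by rewrite /union_of bigcup_image.
have al_proper n k : al n k <> setT.
  move=> alX; apply: (UsP n).2; exists (u n @` `I_k); split.
  - by move=> _ [i _ <-].
  - exact: finite_image.
  - split.
    + exact/finite_set_countable/finite_image.
    + by move=> _ [i _ <-].
    + by rewrite al_union.
    + by move=> [i _ uX]; have [_ _ _] := UsC n; apply; rewrite -uX.
have al_out n k : exists x, ~ al n k x.
  apply/existsNP => allx; apply: (al_proper n k); apply/seteqP.
  by split=> // x _; exact: allx.
pose b n k := \bigcap_(m in `I_n.+1) al m k.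
have [n|V [nu [[_ gV] nu_inj VP]]] := disp (fun n => range (b n)).
  have bomega (F : set X) : finite_set F -> exists2 W, range (b n) W & F `<=` W.
    move=> finF; have [x Fx|x k k' kk' bx m mn|k kP] :=
      finite_set_bounded (Q := fun x k => b n k x) finF.
    - apply: finite_set_bounded (finite_II _) _ _ => [m _|m k k' kk'].
        exact: al_cover.
      exact: al_mono.
    - exact: al_mono kk' _ (bx m mn).
    - by exists (b n k) => //; exists k.
  split=> //; split.
  - exact/(sub_countable (card_image_le _ _))/countableP.
  - by move=> _ [k _ <-]; exact: open_bigcap_finite (finite_II _) _.
  - apply/seteqP; split=> // x _; have [W bW xW] := bomega _ (finite_set1 x).
    by exists W => //; exact: xW.
  - move=> [k _ bX]; apply: (al_proper n k); apply/seteqP; split=> // x _.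
    by have : b n k x; [rewrite bX|apply; exact: leqnn].
have V_al W m : V W -> m <= nu W -> exists k, W `<=` al m k.
  by move=> VW mW; have [_ [k _ <-] Wb] := VP W VW; exists k => x /Wb; apply.
have V_bounded (S : set (set X)) m : finite_set S -> S `<=` V ->
    (forall W, S W -> m <= nu W) -> exists k, union_of S `<=` al m k.
  move=> finS SV mS; have [W SW|W k k' kk' Wk|k kP] :=
    finite_set_bounded (Q := fun W k => W `<=` al m k) finS.
  - by apply: V_al; [exact: SV|exact: mS].
  - exact: subset_trans Wk (al_mono _ _ _ kk').
  - by exists k => x [W /kP]; exact.
have V_not_cover (S : set (set X)) : finite_set S -> S `<=` V -> ~ covers X S.
  move=> finS SV [_ _ SX _].
  have [//|k kP] := V_bounded S 0 finS SV; apply: (al_proper 0 k).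
  by apply/seteqP; split=> // x _; apply: kP; rewrite SX.
case: gV => [[_ [P [[PV _ _] /infinite_setN0[F PF] Pcov]]]|].
  have [finF Fcov] := Pcov F PF; case: (V_not_cover F) => // W FW.
  by rewrite -PV; exists F.
move=> [P [[PV Ptriv Pne] Pfin]]; set E := (E in B E) => BE.
have PsubV F : P F -> F `<=` V by move=> PF W FW; rewrite -PV; exists F.
have /choice[pc pcP] : forall e, exists F, E e -> P F /\ e = union_of F.
  move=> e; have [[[F PF <-] _]|?] := pselect (E e); last by exists set0.
  by exists F.
have /choice[rho rhoP] : forall e, exists n, E e ->
    (exists2 W, pc e W & nu W = n) /\ forall W, pc e W -> n <= nu W.
  move=> e; have [Ee|?] := pselect (E e); last by exists 0.
  have ex : exists n, `[< exists2 W, pc e W & nu W = n >].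
    have [W pW] := Pne _ (pcP e Ee).1.
    by exists (nu W); apply/asboolP; exists W.
  case: (ex_minnP ex) => n /asboolP nP nmin; exists n => _; split=> // W pW.
  by apply: nmin; apply/asboolP; exists W.
(* Different pieces of the partition are disjoint and [nu] is injective on [V]. *)
have rho_inj e e' : E e -> E e' -> rho e = rho e' -> e = e'.
  move=> Ee Ee' ee'; have [[W pW nW] _] := rhoP e Ee.
  have [[W' pW' nW'] _] := rhoP e' Ee'.
  have [PF eF] := pcP e Ee; have [PF' eF'] := pcP e' Ee'.
  rewrite eF eF'; congr union_of; apply: Ptriv => //; exists W; split=> //.
  rewrite (nu_inj W W') ?inE ?nW ?nW'//; first exact: PsubV pW.
  exact: PsubV pW'.
have E_al e m : E e -> m <= rho e -> exists k, e `<=` al m k.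
  move=> Ee me; have [PF ->] := pcP e Ee.
  apply: V_bounded; [exact: Pfin|exact: PsubV|] => W pW.
  by apply: leq_trans me _; apply: (rhoP e Ee).2.
have /choice[inv invP] : forall n, exists e', forall e, E e -> rho e = n -> e' = e.
  move=> n; have [[e' [Ee' <-]]|ne] := pselect (exists e, E e /\ rho e = n).
    by exists e' => e Ee /esym; exact: rho_inj.
  by exists set0 => e Ee en; case: ne; exists e.
have rho_fin N : finite_set [set e | E e /\ rho e < N].
  apply: sub_finite_set (finite_image inv (finite_II N)) => e [Ee eN].
  by exists (rho e) => //; exact: invP.
have E_bounded m N : exists k, forall e, E e -> m <= rho e < N -> e `<=` al m k.
  have [e [Ee eN]|e k k' kk' ek|k kP] := finite_set_bounded
    (Q := fun e k => m <= rho e -> e `<=` al m k) (rho_fin N).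
  - have [/(E_al _ _ Ee)[k ek]|//] := boolP (m <= rho e); first by exists k.
    by exists 0.
  - by move=> /ek /subset_trans; apply; exact: al_mono.
  - by exists k => e Ee /andP[me eN]; exact: kP.
have [_ EO EX EnX] := B_covers _ BE.
have /choice[far farP] : forall N, exists e, E e /\ N <= rho e.
  move=> N; have [k kP] := E_bounded 0 N; have [x xk] := al_out 0 k.
  have [e Ee ex] : union_of E x by rewrite EX.
  exists e; split=> //; rewrite leqNgt; apply/negP => eN; apply: xk.
  exact: kP ex.
have [|a [kappa [a0 aS a_le kappaE]]] := @intervals (fun N => (rho (far N)).+1).
  by move=> N; rewrite ltnS; exact: (farP N).2.
have kappaP n : a (kappa n) <= n < a (kappa n).+1 by rewrite -kappaE.
have a_ge k : k <= a k.
  elim: k => // k IHk; rewrite aS ltnS; apply: leq_trans IHk _.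
  exact: (farP _).2.
have zeta_surj k : exists e, E e /\ kappa (rho e) = k.
  exists (far (a k)); have [Ee ae] := farP (a k); split=> //.
  by apply/eqP; rewrite kappaE ae aS leqnn.
have /choice[K0 K0P] : forall k, exists K0, forall e, E e ->
    kappa (rho e) = k -> e `<=` al k K0.
  move=> k; have [K0 K0P] := E_bounded k (a k.+1); exists K0 => e Ee ek.
  apply: K0P => //; have /andP[ke] := kappaP (rho e).
  by rewrite ek in ke *; rewrite (leq_trans (a_ge k) ke).
have [K [K0K K_inj]] := separated_bounds K0 al_mono al_cover al_proper.
pose f e := al (kappa (rho e)) (K (kappa (rho e))).
have sub_f e : E e -> e `<=` f e.
  by move=> Ee; apply: subset_trans (K0P _ e Ee erefl) (al_mono _ _ _ (K0K _)).
exists (fun n => u n @` `I_(K n)); split=> [n|].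
  by split; [move=> _ [i _ <-]|exact: finite_image].
rewrite (_ : (fun n => _) = (fun n => al n (K n))); last exact/funext.
apply: (B_derefinable _ _ BE).
  split.
  - exact/(sub_countable (card_image_le _ _))/countableP.
  - by move=> _ [n _ <-].
  - apply/seteqP; split=> // x _; have [e Ee ex] : union_of E x by rewrite EX.
    by exists (f e); [exists (kappa (rho e))|exact: sub_f ex].
  - by move=> [n _ /al_proper].
exists f; split=> //.
- apply/seteqP; split=> [_ [e _ <-]|_ [n _ <-]]; first by exists (kappa (rho e)).
  by have [e [Ee en]] := zeta_surj n; exists e => //; rewrite /f en.
- move=> _ [n _ <-]; apply: sub_finite_set (rho_fin (a n.+1)) => e [Ee].
  move=> /K_inj en; split=> //; have /andP[_] := kappaP (rho e).
  by rewrite en.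
Qed.

End FromDispersed.

Theorem theorem15 (X : topologicalType) (B : set (set (set X)))
    (X_nonempty : [set: X] !=set0)
    (B_covers : B `<=` covers X)
    (B_ramseyan : ramseyan B)
    (B_derefinable : finite_to_one_derefinable B) :
  [<-> S1 (covers X) (covers X) /\ Ufin (covers X) B;
       S1 (large_covers X) (gimel B);
       S1 (omega_covers X) (gimel B);
       ~ ONE_wins_G1 (omega_covers X) (gimel B);
       arrows (omega_covers X) (gimel B) 2 2;
       forall k : nat, (0 < k)%N -> arrows (omega_covers X) (gimel B) 2 k].
Proof.
have gimel_covers : gimel B `<=` covers X by move=> U [].
have back : dispersed_selection (gimel B) ->
    S1 (covers X) (covers X) /\ Ufin (covers X) B.
  move=> disp; split; first exact: rothberger_of_dispersed disp.
  exact: Ufin_of_dispersed disp.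
have play : S1 (covers X) (covers X) /\ Ufin (covers X) B ->
    forall A, A `<=` large_covers X -> S1 A (gimel B) /\ ~ ONE_wins_G1 A (gimel B).
  move=> [roth ufin] A Alarge; apply: S1_and_no_winning_strategy => tau tauP.
  have [|V [VP Vlarge]] := rothberger_game_large X_nonempty roth (tau := tau).
    by move=> h; exact/Alarge/tauP.
  by exists V; split=> //; exact: large_sub_gimel Vlarge.
tfae.
- by move=> /play/(_ _ (@subset_refl _ _))[].
- move=> sel Us UsP; apply: sel => n; exact: omega_large.
- by move=> /dispersed_of_S1/back/play/(_ _ (@omega_large X))[].
- exact: arrows_of_no_winning_strategy.
- move=> /(dispersed_of_arrows gimel_covers)/back/play.
  move=> /(_ _ (@omega_large X))[_ noWin] k _.
  exact: arrows_of_no_winning_strategy.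
- by move=> /(_ 2 isT)/(dispersed_of_arrows gimel_covers)/back.
Qed.
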